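(* Let $q=p^s$ with $p$ an odd prime, let $n$ be a positive integer and let $\lambda\in\mathbb{F}_{q^n}$. Let $N_n(\mathcal C_1)$ denote the number of pairs $(x,y)\in\mathbb{F}_{q^n}^2$ satisfying $y^q-y=x^{q+1}-x^2-\lambda$. Then \[N_n(\mathcal C_1)= \begin{cases} q^{n}- \chi\big(2(-1)^{n/2}n\,\mathrm{Tr}(\lambda)\big)q^{(n+2)/2} & \text{if } \gcd(n,p) = 1 \text{ and } n \text{ is even;}\\ q^{n}+ \varepsilon_{\mathrm{Tr}(\lambda)} \chi\big((-1)^{(n-1)/2}n\big)q^{(n+1)/2} &\text{if } \gcd(n,p) = 1 \text{ and } n \text{ is odd;}\\ q^{n}-\varepsilon_{\mathrm{Tr}(\lambda)} \chi\big((-1)^{n/2}\big) q^{(n+2)/2} &\text{if } \gcd(n,p) = p \text{ and } n\text{ is even;}\\ q^{n} +\chi\big(2(-1)^{(n-3)/2}\mathrm{Tr}(\lambda)\big)q^{(n+3)/2} &\text{if } \gcd(n,p) = p \text{ and } n \text{ is odd.} \end{cases}\]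
   Context: $\mathrm{Tr}:\mathbb{F}_{q^n}\to\mathbb{F}_q$ is the trace map $x\mapsto x+x^q+\dots+x^{q^{n-1}}$. $\chi$ denotes the quadratic character of $\mathbb{F}_q$, with the convention $\chi(0)=0$; integers appearing inside $\chi$ are viewed as elements of $\mathbb{F}_q$. For $\alpha\in\mathbb{F}_q$, $\varepsilon_\alpha=q-1$ if $\alpha=0$ and $\varepsilon_\alpha=-1$ otherwise. *)

(* Defs.v *)
From mathcomp Require Export all_boot all_order all_algebra all_field.

Set Implicit Arguments.
Unset Strict Implicit.
Unset Printing Implicit Defensive.

Import GRing.Theory.
Local Open Scope ring_scope.

Definition quad_char (F : finFieldType) (a : F) : int :=
  if a == 0 then 0 else if [exists b : F, b ^+ 2 == a] then 1 else - 1.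

Definition eps (F : finFieldType) (a : F) : int :=
  if a == 0 then #|F|%:Z - 1 else - 1.

Definition trace_sum (F : finFieldType) (L : fieldExtType F) (x : L) : L :=
  \sum_(i < \dim {:L}) x ^+ (#|F| ^ i).

(* The trace as an element of F: the preimage of [trace_sum x] under the
   embedding of F in L. It exists by [fin_traceE], so the default 0 is never
   used. *)
Definition fin_trace (F : finFieldType) (L : fieldExtType F) (x : L) : F :=
  odflt 0 [pick t : F | t%:A == trace_sum x].

Lemma card_finField_pnat (F : finFieldType) (p : nat) :
  p \in [pchar F] -> p.-nat #|F|.
Proof.
move=> pF; rewrite (card_pprimeChar pF) pnatX.
by rewrite pnat_id ?(pcharf_prime pF).
Qed.

Lemma fin_traceE (F : finFieldType) (L : fieldExtType F) (x : L) :
  (fin_trace x)%:A = trace_sum x.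
Proof.
have xqn : x ^+ (#|F| ^ \dim {:L}) = x.
  by apply/eqP; rewrite -(Fermat's_little_theorem {:L}%AS) memvf.
have [p p_pr pF] := finPcharP F.
have pL : p \in [pchar L] by rewrite pchar_lalg.
suff : trace_sum x \in 1%VS.
  case/vlineP=> t xt; rewrite /fin_trace; case: pickP => [u /eqP // | /(_ t)].
  by rewrite xt eqxx.
rewrite (Fermat's_little_theorem 1%AS) dimv1 expn1 /trace_sum; apply/eqP.
have powD (y z : L) : (y + z) ^+ #|F| = y ^+ #|F| + z ^+ #|F|.
  apply: exprDn_pchar; apply: sub_in_pnat (card_finField_pnat pF) => r _ /=.
  by rewrite inE => /eqP->.
have pow0 : (0 : L) ^+ #|F| = 0 by rewrite expr0n gtn_eqF // ltnW ?finNzRing_gt1.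
rewrite (big_morph (fun y : L => y ^+ #|F|) powD pow0).
have: (0 < \dim {:L})%N by rewrite adim_gt0.
case: (\dim {:L}) xqn => // m xqn _.
rewrite big_ord_recr [RHS]big_ord_recl /= -exprM -expnSr xqn expn0 expr1 addrC.
by congr (_ + _); apply: eq_bigr => i _; rewrite -exprM -expnSr.
Qed.

(* [finvect_type L] is L equipped with a structure of finite type; the equation
   itself is stated in L. *)
Definition curve_points (F : finFieldType) (L : fieldExtType F) (lambda : L) :
    {set finvect_type L * finvect_type L} :=
  [set xy : finvect_type L * finvect_type L |
    let x : L := xy.1 in let y : L := xy.2 in
    y ^+ #|F| - y == x ^+ (#|F|.+1) - x ^+ 2 - lambda].

(* Main.v *)
(** The map [x |-> x^q - x] is [q]-to-one onto the kernel of the trace, and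
    [2 Tr (x^(q+1) - x^2) = - Tr ((x^q - x)^2)], so that [N] is [q^2] times the
    number [h] of [z] with [Tr z = 0] and [Tr z^2 = - 2 Tr lambda =: c].  On the
    other hand the equation [Tr z^2 - n s^2 = c] in [(z, s)] has
    [q h + q^n - q^(n-1)] solutions, as the substitution [z = w + s] makes it
    linear in [s].  If [p] divides [n], this equation is the nondegenerate form
    [Tr z^2] with a dummy variable; otherwise it is a nondegenerate form in
    [n + 1] variables.  Both numbers of solutions follow from the
    determinant of the trace form, which is a square exactly when [n] is odd. *)

Require Import Defs.
From HB Require Import structures.
From mathcomp Require Import perm ring zify.
Set Implicit Arguments.
Unset Strict Implicit.
Unset Printing Implicit Defensive.

Import GRing.Theory Num.Theory VectorInternalTheory.
Local Open Scope ring_scope.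

(** * Indicator sums and the quadratic character *)

(** Used to regroup sums along the fibres of a map: a term [g (f x)] is expanded over the possible
    values of [f x], and the two sums are exchanged. *)
Lemma sum_delta (T : finType) (g : T -> int) (a : T) :
  \sum_x (a == x)%:R * g x = g a.
Proof.
rewrite (bigD1 a) //= eqxx mul1r big1 ?addr0 // => x /negPf xa.
by rewrite eq_sym xa mul0r.
Qed.

Lemma sum_nat_of_bool (T : finType) (P : pred T) :
  \sum_x (P x)%:R = #|[pred x | P x]|%:Z.
Proof.
rewrite -sum1_card -natz natr_sum [RHS]big_mkcond; apply: eq_bigr => x _.
by rewrite inE; case: (P x).
Qed.

Lemma sum_sqr_eq (F : finFieldType) (a : F) :
  2%:R != 0 :> F -> \sum_(x : F) (x ^+ 2 == a)%:R = 1 + quad_char a.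
Proof.
move=> F2; rewrite /quad_char; case: eqP => [->|/eqP a0].
  rewrite addr0 (bigD1 0) //= expr0n eqxx big1 ?addr0 // => x /negPf x0.
  by rewrite sqrf_eq0 x0.
case: existsP => [[b /eqP ba]|no].
  have b0 : b != 0 by apply: contraNneq a0 => b0; rewrite -ba b0 expr0n.
  have bN : - b != b.
    by rewrite -subr_eq0 -opprD oppr_eq0 -mulr2n -mulr_natl mulf_neq0.
  rewrite (bigD1 b) //= (bigD1 (- b)) //= sqrrN ba eqxx big1 ?addr0 //.
  by move=> x /andP[/negPf xb /negPf xNb]; rewrite -ba eqf_sqr xb xNb.
rewrite subrr big1 // => x _; case: eqP => // xa.
by case: no; exists x; rewrite xa.
Qed.

Lemma sum_sqr (F : finFieldType) (g : F -> int) :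
  2%:R != 0 :> F ->
  \sum_(x : F) g (x ^+ 2) = \sum_a (1 + quad_char a) * g a.
Proof.
move=> F2; under eq_bigr => x _ do rewrite -(sum_delta g).
rewrite exchange_big /=; apply: eq_bigr => a _.
by rewrite -mulr_suml sum_sqr_eq.
Qed.

Lemma quad_char0 (F : finFieldType) : quad_char (0 : F) = 0.
Proof. by rewrite /quad_char eqxx. Qed.

Lemma quad_char_sqr (F : finFieldType) (a : F) :
  a != 0 -> quad_char (a ^+ 2) = 1.
Proof.
move=> a0; rewrite /quad_char sqrf_eq0 (negPf a0).
by case: existsP => // [[]]; exists a.
Qed.

Lemma quad_char1 (F : finFieldType) : quad_char (1 : F) = 1.
Proof. by rewrite -(expr1n F 2) quad_char_sqr ?oner_neq0. Qed.

(** Sorting the elements of [F] by their squares gives [q = q + \sum_a quad_char a]. *)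
Lemma sum_quad_char (F : finFieldType) :
  2%:R != 0 :> F -> \sum_(a : F) quad_char a = 0.
Proof.
move=> F2; have := sum_sqr (fun=> 1) F2.
under [X in _ = X -> _]eq_bigr => a _ do rewrite mulr1.
rewrite big_split /= => /eqP.
by rewrite -subr_eq0 opprD addNKr oppr_eq0 => /eqP.
Qed.

Lemma quad_charMsqr (F : finFieldType) (a b : F) :
  b != 0 -> quad_char (b ^+ 2 * a) = quad_char a.
Proof.
move=> b0; rewrite /quad_char mulf_eq0 sqrf_eq0 (negPf b0) /=.
case: eqP => // _; congr (if _ then _ else _).
apply/existsP/existsP => [[c /eqP ca]|[c /eqP <-]]; last first.
  by exists (b * c); rewrite exprMn.
by exists (c / b); rewrite expr_div_n ca mulrAC divff ?mul1r // sqrf_eq0.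
Qed.

Lemma quad_charP (F : finFieldType) (a : F) :
  [\/ a = 0 /\ quad_char a = 0,
      exists2 b, b != 0 & a = b ^+ 2 /\ quad_char a = 1
    | a != 0 /\ quad_char a = -1].
Proof.
rewrite /quad_char; case: (eqVneq a 0) => [|a0]; first by constructor 1.
case: existsP => [[b /eqP ba]|]; last by constructor 3.
constructor 2; exists b => //; apply: contraNneq a0 => b0.
by rewrite -ba b0 expr0n.
Qed.

(* For a nonsquare [a], each [quad_char b + quad_char (a * b)] is nonpositive,
   while these integers sum to [0]; hence they all vanish. *)
Lemma quad_charM (F : finFieldType) (a b : F) :
  2%:R != 0 :> F -> quad_char (a * b) = quad_char a * quad_char b.
Proof.
move=> F2; case: (quad_charP a) => [[-> ->]|[c c0 [-> ->]]|[a0 aN]].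
- by rewrite !mul0r quad_char0.
- by rewrite quad_charMsqr // mul1r.
pose f x := - (quad_char x + quad_char (a * x)).
have f0 x : 0 <= f x.
  rewrite /f; case: (quad_charP x) => [[-> ->]|[c c0 [-> ->]]|[x0 ->]].
  - by rewrite mulr0 quad_char0.
  - by rewrite mulrC quad_charMsqr // aN.
  by case: (quad_charP (a * x)) => [[_ ->]|[? _ [_ ->]]|[_ ->]].
have : \sum_x f x = 0.
  rewrite sumrN big_split /= sum_quad_char // add0r.
  have := sum_quad_char F2.
  by rewrite (reindex_inj (mulfI a0)) /= => ->; rewrite oppr0.
move/eqP; rewrite psumr_eq0 // => /allP /(_ b (mem_index_enum _)).
by rewrite /f oppr_eq0 aN => /eqP; lia.
Qed.

Lemma quad_char_sqr1 (F : finFieldType) (a : F) :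
  a != 0 -> quad_char a * quad_char a = 1.
Proof.
by case: (quad_charP a) => [[-> _]|[? _ [_ ->]]|[_ ->]] //; rewrite eqxx.
Qed.

Lemma epsE (F : finFieldType) (c : F) :
  eps c = #|F|%:Z * (c == 0)%:R - 1.
Proof. by rewrite /eps; case: eqP; rewrite ?mulr1 ?mulr0 ?add0r. Qed.

(** For [c != 0] and [x != 0], [x * (c - x)] is [c / x - 1] up to a nonzero square. This takes every
    value except [-1], and the complete character sum vanishes. *)
Lemma jacobi_sum (F : finFieldType) (c : F) :
  2%:R != 0 :> F ->
  \sum_(x : F) quad_char x * quad_char (c - x) = quad_char (-1 : F) * eps c.
Proof.
move=> F2; under eq_bigr => x _ do rewrite -quad_charM //.
rewrite (bigD1 0) //= mul0r quad_char0 add0r /eps.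
case: eqP => [->|/eqP c0].
  under eq_bigr => x x0 do rewrite sub0r mulrN -mulN1r mulrC quad_charMsqr //.
  rewrite sumr_const cardC1 -mulr_natr; congr (_ * _).
  by rewrite natz -[in RHS](ltn_predK (finNzRing_gt1 F)) intS addrAC subrr add0r.
have F0 x : x != 0 -> quad_char (x * (c - x)) = quad_char (c / x - 1).
  move=> x0; rewrite -[RHS](@quad_charMsqr _ _ x) //; congr quad_char.
  by field.
under eq_bigr => x x0 do rewrite F0 //.
(* As [0^-1 = 0], this is an involution of all of [F]; the point [0] accounts for the missing value
   [-1]. *)
have h0 : bijective (fun u : F => c / u).
  by exists (fun u : F => c / u) => u; rewrite invf_div mulrCA divff ?mulr1.
have := sum_quad_char F2.
rewrite (reindex_inj (addIr (- 1))) /= (reindex_inj (bij_inj h0)) /=.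
rewrite (bigD1 0) //= invr0 mulr0 sub0r => /eqP.
by rewrite addrC addr_eq0 mulrN1 => /eqP.
Qed.
Lemma sum_eps (F : finFieldType) : \sum_(x : F) eps x = 0.
Proof.
under eq_bigr => x _ do rewrite epsE -[(_ == _)%:R]mulr1 eq_sym.
rewrite big_split /= -mulr_sumr (sum_delta (fun=> 1)) mulr1.
by rewrite sumr_const mulNrn natz subrr.
Qed.

(** * Counting solutions of nondegenerate quadratic equations *)

(** An element [y] has [1 + quad_char y] square roots; rescaling the summation variable by [a]
    brings out [quad_char a]. *)
Lemma sum_sub_sqr (F : finFieldType) (g : F -> int) (a c : F) :
  2%:R != 0 :> F -> a != 0 ->
  \sum_(x : F) g (c - a * x ^+ 2)
  = \sum_x g x + quad_char a * \sum_x quad_char x * g (c - x).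
Proof.
move=> F2 a0; rewrite (sum_sqr (fun y => g (c - a * y))) //.
under eq_bigr => x _ do rewrite mulrDl mul1r.
rewrite big_split /=; congr (_ + _).
  by rewrite [RHS](reindex_inj (subrI c)) [RHS](reindex_inj (mulfI a0)).
rewrite mulr_sumr [RHS](reindex_inj (mulfI a0)) /=; apply: eq_bigr => x _.
by rewrite quad_charM // !mulrA quad_char_sqr1 ?mul1r.
Qed.

(* [q] times the number of solutions of [Q v = c] for a nondegenerate quadratic
   form [Q] of determinant [d] in [m] variables; the factor [q] keeps the
   exponents of [q] nonnegative when [m = 0]. *)
Definition form_count (F : finFieldType) (m : nat) (d c : F) : int :=
  let q : int := #|F|%:Z in
  q ^+ m + if odd m then quad_char ((-1) ^+ m./2 * d * c) * q ^+ m./2.+1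
           else eps c * quad_char ((-1) ^+ m./2 * d) * q ^+ m./2.

(** The effect of one more diagonal entry [a]. The second term of [form_count] has sum zero over
    [c], so only its convolution with [quad_char] survives: a Jacobi sum for odd [m], and a single
    term for even [m], since [eps] is [q] times an indicator minus [1]. *)
Lemma sum_form_count (F : finFieldType) (m : nat) (a d c : F) :
  2%:R != 0 :> F -> a != 0 ->
  \sum_(x : F) form_count m d (c - a * x ^+ 2) = form_count m.+1 (a * d) c.
Proof.
move=> F2 a0; rewrite big_split /= sumr_const -[_ *+ _]mulr_natl natz -exprS.
rewrite [RHS]/form_count /= uphalf_half; congr (_ + _).
case: (odd m) => /=; rewrite ?add0n ?add1n -?mulr_suml; last first.
  rewrite exprS mulrA; congr (_ * _).
  rewrite (sum_sub_sqr _ c F2 a0).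
  rewrite sum_eps add0r.
  under eq_bigr => x _ do rewrite epsE mulrBr mulr1 mulrCA subr_eq0.
  rewrite sumrB sum_quad_char // subr0 -mulr_sumr.
  under eq_bigr => x _ do rewrite mulrC.
  by rewrite sum_delta !quad_charM //; ring.
congr (_ * _).
rewrite (sum_sub_sqr (fun y => quad_char ((-1) ^+ m./2 * d * y)) c F2 a0).
under eq_bigr => x _ do rewrite quad_charM //.
rewrite -mulr_sumr sum_quad_char // mulr0 add0r.
under eq_bigr => x _ do rewrite quad_charM // mulrCA.
rewrite -mulr_sumr jacobi_sum // exprS !quad_charM //; ring.
Qed.

Lemma form_countMsqr (F : finFieldType) (m : nat) (b d c : F) :
  b != 0 -> form_count m (b ^+ 2 * d) c = form_count m d c.
Proof.
by move=> b0; rewrite /form_count mulrCA -(mulrA (b ^+ 2)) !quad_charMsqr.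
Qed.

Definition form_sols (F : finFieldType) (m : nat) (A : 'M[F]_m) (c : F) : int :=
  \sum_(v : 'rV[F]_m) (v *m A *m v^T == c%:M)%:R.

Lemma form_sols_congr (F : finFieldType) (m : nat) (A P : 'M[F]_m) (c : F) :
  P \in unitmx -> form_sols (P *m A *m P^T) c = form_sols A c.
Proof.
move=> uP; rewrite [RHS]/form_sols.
rewrite (reindex_inj (can_inj (mulmxK uP) : injective (mulmx^~ P))) /=.
by apply: eq_bigr => v _; rewrite trmx_mul !mulmxA.
Qed.

Lemma form_sols_block (F : finFieldType) (m : nat) (a c : F) (A : 'M[F]_m) :
  form_sols (block_mx (a%:M : 'M_1) 0 0 A) c
  = \sum_(x : F) form_sols A (c - a * x ^+ 2).
Proof.
pose h (u : F * 'rV[F]_m) := row_mx (u.1%:M : 'M_1) u.2.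
pose h' (v : 'rV[F]_(1 + m)) := (lsubmx v 0 0, rsubmx v).
rewrite /form_sols pair_big /= (reindex h); last first.
  exists h' => [[x w] _|v _]; rewrite /h' /h /=.
    by rewrite row_mxKl row_mxKr mxE eqxx mulr1n.
  by rewrite -mx11_scalar hsubmxK.
apply: eq_bigr => -[x w] _; rewrite /h /=; congr (_%:R); congr nat_of_bool.
rewrite tr_row_mx mul_row_block !mulmx0 addr0 add0r mul_row_col.
rewrite tr_scalar_mx -!scalar_mxM.
have -> : (c - a * x ^+ 2)%:M = c%:M - (x * a * x)%:M :> 'M[F]_1.
  by rewrite -raddfB; congr (_%:M); ring.
by rewrite [RHS]eq_sym subr_eq eq_sym addrC.
Qed.

(** Polarization: if all vectors were isotropic, symmetry would give [2 u A v^T = 0] for all [u] and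
    [v], hence [A = 0]. *)
Lemma non_isotropic (F : finFieldType) (m : nat) (A : 'M[F]_m) :
  2%:R != 0 :> F -> A^T = A -> A != 0 ->
  exists v : 'rV[F]_m, v *m A *m v^T != 0.
Proof.
move=> F2 symA A0; case: (pickP (fun v : 'rV_m => v *m A *m v^T != 0)).
  by move=> v; exists v.
move=> no; case/eqP: A0.
have iso (v : 'rV_m) : v *m A *m v^T = 0 by apply/eqP; have /negbFE := no v.
have orth (u v : 'rV_m) : u *m A *m v^T = 0.
  have := iso (u + v); rewrite linearD /= !mulmxDl !mulmxDr !iso add0r addr0.
  (* A 1 by 1 matrix equals its transpose. *)
  have -> : v *m A *m u^T = u *m A *m v^T.
    rewrite [LHS]mx11_scalar -tr_scalar_mx -mx11_scalar.
    by rewrite !trmx_mul trmxK symA mulmxA.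
  rewrite -mulr2n -scaler_nat => /eqP; rewrite scaler_eq0 (negPf F2) /=.
  by move/eqP.
apply/matrixP => i j; have := orth (delta_mx 0 i) (delta_mx 0 j).
rewrite -rowE trmx_delta -colE => /matrixP /(_ 0 0).
by rewrite !mxE.
Qed.

(** One step of diagonalization: a non-isotropic vector becomes, up to scaling, the first basis
    vector, and completing the square clears the rest of its row and column. *)
Lemma split_form (F : finFieldType) (m : nat) (A : 'M[F]_(1 + m)) :
  2%:R != 0 :> F -> A^T = A -> A != 0 ->
  exists P : 'M[F]_(1 + m), exists a : F, exists C : 'M[F]_m,
    [/\ P \in unitmx, a != 0, C^T = C
      & P *m A *m P^T = block_mx (a%:M : 'M_1) 0 0 C].
Proof.
move=> F2 symA /(non_isotropic F2 symA) [v vA].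
have v0 : v != 0 by apply: contraNneq vA => ->; rewrite !mul0mx.
(* An invertible matrix whose first row is proportional to [v]. *)
pose P0 := row_ebase v; pose B := P0 *m A *m P0^T.
have symB : B^T = B by rewrite !trmx_mul trmxK symA mulmxA.
pose a : F := ulsubmx B 0 0; pose b := ursubmx B.
have ulB : ulsubmx B = a%:M by rewrite -mx11_scalar.
have dlB : dlsubmx B = b^T by rewrite /b -[in RHS]symB trmx_ursub trmxK.
have a0 : a != 0.
  have [k vk] : exists k, v = k *: usubmx P0.
    exists (col_ebase v 0 0).
    rewrite -[LHS]mulmx_ebase rank_rV v0 -mul_scalar_mx -mx11_scalar.
    rewrite -mulmxA -/P0 -{1}(vsubmxK P0) pid_mx_row.
    by rewrite mul_row_col mul1mx mul0mx addr0.
  apply: contraNneq vA => a0; rewrite {1 2}vk linearZ -scalemxAr -!scalemxAl.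
  have -> : usubmx P0 *m A *m (usubmx P0)^T = ulsubmx B.
    rewrite /B -[in RHS](vsubmxK P0).
    by rewrite tr_col_mx mul_col_mx mul_col_row block_mxKul.
  by rewrite ulB a0 raddf0 !scaler0 eqxx.
(* The row operation that clears [b^T]; the lower right block becomes the Schur complement of
   [a]. *)
pose E : 'M[F]_(1 + m) := block_mx 1%:M 0 (- a^-1 *: b^T) 1%:M.
exists (E *m P0), a, (drsubmx B - a^-1 *: (b^T *m b)); split => //.
- rewrite unitmx_mul row_ebase_unit andbT unitmxE det_lblock !det1 mulr1.
  exact: unitr1.
- by rewrite linearB linearZ /= trmx_mul trmxK trmx_drsub symB.
have -> : E *m P0 *m A *m (E *m P0)^T = E *m B *m E^T.
  by rewrite trmx_mul !mulmxA.
rewrite -{1}(submxK B) ulB dlB -/b tr_block_mx !mulmx_block.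
rewrite !trmx1 !trmx0 !linearZ /= trmxK.
rewrite !(mul1mx, mulmx1, mul0mx, mulmx0, addr0, add0r).
have -> : - a^-1 *: (a%:M *m b) + b = 0.
  by rewrite mul_scalar_mx scalerA mulNr mulVf // scaleN1r addNr.
have -> : (- a^-1 *: b^T) *m a%:M + b^T = 0.
  by rewrite -scalemxAl mul_mx_scalar scalerA mulNr mulVf // scaleN1r addNr.
by rewrite mul0mx scaler0 add0r -scalemxAl scaleNr scalerN addrC.
Qed.

(** Induction on [m], splitting off one variable at a time. The congruence multiplies the
    determinant by a nonzero square, which [form_count] does not see. *)
Lemma card_form_sols (F : finFieldType) (m : nat) (A : 'M[F]_m) (c : F) :
  2%:R != 0 :> F -> A^T = A -> A \in unitmx ->
  #|F|%:Z * form_sols A c = form_count m (\det A) c.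
Proof.
move=> F2; elim: m A c => [|m IHm] A c symA uA.
  (* With no variables, the only vector is a solution exactly when [c = 0], and [1 + eps c] is [q]
     or [0] accordingly. *)
  rewrite /form_count /form_sols (eq_bigr (fun=> (c == 0)%:R)) => [|v _].
    rewrite sumr_const card_mx muln0 mulr1n det_mx00 epsE.
    by rewrite mulr1 quad_char1 !mulr1 addrC subrK.
  rewrite (thinmx0 v) !mul0mx eq_sym; congr (nat_of_bool _)%:R.
  apply/eqP/eqP => [/matrixP /(_ 0 0)|->]; last exact: raddf0.
  by rewrite !mxE eqxx.
have A0 : A != 0.
  by apply: contraTneq uA => ->; rewrite unitmxE det0 unitr0.
have [P [a [C [uP a0 symC PAP]]]] := @split_form F m A F2 symA A0.
have detA : \det P ^+ 2 * \det A = a * \det C.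
  have := congr1 determinant PAP.
  by rewrite !det_mulmx det_tr det_ublock det_scalar1 mulrAC.
have uC : C \in unitmx.
  rewrite unitmxE unitfE; apply: contraTneq uA => C0.
  rewrite unitmxE unitfE negbK; move/eqP: detA.
  rewrite C0 mulr0 mulf_eq0 sqrf_eq0 -[_ == 0]negbK -unitfE -unitmxE.
  by rewrite (uP : P \in unitmx).
rewrite -(form_sols_congr _ _ uP) PAP form_sols_block mulr_sumr.
under eq_bigr => x _ do rewrite IHm //.
by rewrite sum_form_count // -detA form_countMsqr // -unitfE -unitmxE.
Qed.

(** * The Frobenius map and the trace *)

Definition frobenius (F : finFieldType) (L : fieldExtType F) (x : L) : L :=
  x ^+ #|F|.

Fact frobenius_is_zmod_morphism (F : finFieldType) (L : fieldExtType F) :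
  zmod_morphism (@frobenius F L).
Proof.
have [p p_pr pF] := finPcharP F.
have pL : p \in [pchar L] by rewrite pchar_lalg.
have powD (y z : L) : (y + z) ^+ #|F| = y ^+ #|F| + z ^+ #|F|.
  apply: exprDn_pchar; apply: sub_in_pnat (card_finField_pnat pF) => r _ /=.
  by rewrite inE => /eqP->.
by move=> x y; apply: (addIr (y ^+ #|F|)); rewrite /frobenius subrK -powD subrK.
Qed.

HB.instance Definition _ (F : finFieldType) (L : fieldExtType F) :=
  GRing.isZmodMorphism.Build L L (@frobenius F L)
    (@frobenius_is_zmod_morphism F L).

Fact frobenius_is_monoid_morphism (F : finFieldType) (L : fieldExtType F) :
  monoid_morphism (@frobenius F L).
Proof. by split=> [|x y]; rewrite /frobenius ?expr1n ?exprMn. Qed.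

HB.instance Definition _ (F : finFieldType) (L : fieldExtType F) :=
  GRing.isMonoidMorphism.Build L L (@frobenius F L)
    (@frobenius_is_monoid_morphism F L).

Lemma frobeniusP (F : finFieldType) (L : fieldExtType F) (x : L) :
  reflect (exists a : F, x = a%:A) (frobenius x == x).
Proof.
have := Fermat's_little_theorem (1%AS : {subfield L}) x.
by rewrite dimv1 expn1 => <-; apply: (iffP (vlineP _ _)).
Qed.

Lemma frobenius_alg (F : finFieldType) (L : fieldExtType F) (a : F) :
  frobenius (a%:A : L) = a%:A.
Proof. by apply/eqP/frobeniusP; exists a. Qed.

Lemma expXcard (F : finFieldType) (L : fieldExtType F) (x : L) i :
  x ^+ (#|F| ^ i) = iter i (@frobenius F L) x.
Proof. by elim: i => // i IH; rewrite iterS -IH /frobenius -exprM -expnSr. Qed.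

Lemma alg_inj (F : finFieldType) (L : fieldExtType F) :
  injective (fun a : F => a%:A : L).
Proof. exact: (fmorph_inj (in_alg L)). Qed.

Fact fin_trace_is_linear (F : finFieldType) (L : fieldExtType F) :
  linear_for *%R (@fin_trace F L).
Proof.
move=> a x y; apply: (@alg_inj F L).
rewrite scalerDl -scalerA !fin_traceE /trace_sum scaler_sumr -big_split /=.
apply: eq_bigr => i _; rewrite !expXcard; elim: (val i) => //= k ->.
by rewrite rmorphD -mulr_algl rmorphM /= frobenius_alg mulr_algl.
Qed.

HB.instance Definition _ (F : finFieldType) (L : fieldExtType F) :=
  GRing.isLinear.Build F L F *%R (@fin_trace F L) (@fin_trace_is_linear F L).

Lemma fin_trace_frobenius (F : finFieldType) (L : fieldExtType F) (x : L) :
  fin_trace (frobenius x) = fin_trace x.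
Proof.
apply: (@alg_inj F L); rewrite -[RHS]frobenius_alg !fin_traceE rmorph_sum /=.
by apply: eq_bigr => i _; rewrite !expXcard -iterSr.
Qed.

Lemma fin_trace_alg (F : finFieldType) (L : fieldExtType F) (a : F) :
  fin_trace (a%:A : L) = (\dim {:L})%:R * a.
Proof.
apply: (@alg_inj F L); rewrite fin_traceE /trace_sum.
rewrite (eq_bigr (fun=> a%:A)) => [|i _].
  by rewrite sumr_const card_ord mulr_natl -scalerMnl.
by rewrite expXcard; elim: (val i) => //= k ->; rewrite frobenius_alg.
Qed.

Lemma card_fin_ext (F : finFieldType) (L : fieldExtType F) :
  #|{: finvect_type L}| = (#|F| ^ \dim {:L})%N.
Proof.
have bij : bijective (@r2v F L) by exists v2r; [exact: r2vK | exact: v2rK].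
rewrite -(@bij_eq_card 'rV[F]_(dim L) (finvect_type L) _ bij).
by rewrite card_mx mul1n dimvf.
Qed.

(** Elements of trace zero are roots of a polynomial of degree [q^(n-1)]. Equality will follow from
    the size of the image of [artin_schreier]. *)
Lemma card_ker_trace_le (F : finFieldType) (L : fieldExtType F) :
  (#|[set z : finvect_type L | fin_trace (z : L) == 0%R]|
    <= #|F| ^ (\dim {:L}).-1)%N.
Proof.
have [m dimL] : exists m, \dim {:L} = m.+1.
  by exists (\dim {:L}).-1; rewrite prednK ?adim_gt0.
pose p : {poly L} := \sum_(i < m.+1) 'X^(#|F| ^ i).
have F1 := finNzRing_gt1 F.
have sz : size p = (#|F| ^ m).+1.
  rewrite /p big_ord_recr /= addrC size_polyDl size_polyXn // ltnS.
  apply: leq_trans (size_sum _ _ _) _; apply/bigmax_leqP => i _.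
  by rewrite size_polyXn ltn_exp2l.
rewrite dimL /= -ltnS -sz cardE.
apply: max_poly_roots; rewrite ?enum_uniq //.
  by rewrite -size_poly_eq0 sz.
apply/allP => z; rewrite mem_enum inE => /eqP z0.
have := fin_traceE (z : L); rewrite z0 scale0r /trace_sum dimL => t0.
rewrite rootE horner_sum; under eq_bigr => i _ do rewrite hornerXn.
by rewrite -t0.
Qed.

(** * The map [x^q - x] and the kernel of the trace *)

Definition artin_schreier (F : finFieldType) (L : fieldExtType F) (x : L) : L :=
  frobenius x - x.

Lemma artin_schreier_fiber (F : finFieldType) (L : fieldExtType F) (z : L) :
  \sum_(x : finvect_type L) (artin_schreier (x : L) == z)%:R
  = #|F|%:Z * (fin_trace z == 0)%:R.
Proof.
pose V := finvect_type L; pose f (x : V) : V := artin_schreier (x : L).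
have fib (x0 : V) : #|[pred x : V | f x == f x0]| = #|F|.
  have inj : injective (fun a : F => (x0 : L) + a%:A : V).
    by move=> a b /addrI /alg_inj.
  rewrite -(card_imset predT inj); apply: eq_card => x; rewrite !inE.
  apply/eqP/imsetP => [e|[a _ ->]]; last first.
    rewrite /f /artin_schreier rmorphD /= frobenius_alg.
    by rewrite opprD addrACA subrr addr0.
  have /frobeniusP [a xa] : frobenius ((x : L) - x0) == (x : L) - x0.
    move/eqP: e; rewrite -subr_eq0 /f /artin_schreier => /eqP e.
    by rewrite raddfB -subr_eq0 -e; apply/eqP; ring.
  by exists a => //; rewrite -xa addrC subrK.
have tr0 x : fin_trace (f x : L) = 0.
  by rewrite /f raddfB /= fin_trace_frobenius subrr.
have F1 := finNzRing_gt1 F.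
have im : f @: setT = [set z : V | fin_trace (z : L) == 0].
  apply/eqP; rewrite eqEcard; apply/andP; split.
    by apply/subsetP => _ /imsetP [x _ ->]; rewrite inE tr0.
  apply: leq_trans (card_ker_trace_le L) _.
  (* The [q^n] elements of [L] fall into fibres of size [q], so the image has at least [q^(n-1)]
     elements. *)
  rewrite -(leq_pmul2l (ltnW F1)) -expnS prednK ?adim_gt0 // -card_fin_ext.
  rewrite -cardsT -sum1_card (partition_big_imset f) /=.
  rewrite mulnC -sum_nat_const; apply: leq_sum => _ /imsetP [x _ ->].
  rewrite sum1_card -(fib x).
  by apply: eq_leq; apply: eq_card => y; rewrite unfold_in in_setT.
have [z0|z0] := boolP (fin_trace z == 0); last first.
  rewrite mulr0 big1 // => x _; case: eqP => // xz.
  by case/negP: z0; rewrite -xz; apply/eqP/tr0.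
have : (z : V) \in f @: setT by rewrite im inE.
case/imsetP => x0 _ ->; by rewrite mulr1 -(fib x0) -sum_nat_of_bool.
Qed.

Lemma sum_ker_trace (F : finFieldType) (L : fieldExtType F) :
  #|F|%:Z * \sum_(z : finvect_type L) (fin_trace (z : L) == 0)%:R
  = #|F|%:Z ^+ \dim {:L}.
Proof.
rewrite mulr_sumr; under eq_bigr => z _ do rewrite -artin_schreier_fiber.
rewrite exchange_big /= (eq_bigr (fun=> 1)) => [|x _].
  by rewrite sumr_const natz card_fin_ext -!natz natrX.
under eq_bigr => z _ do rewrite -[_%:R]mulr1.
exact: (sum_delta (fun=> 1)).
Qed.

Lemma fin_trace_neq0 (F : finFieldType) (L : fieldExtType F) :
  exists w : L, fin_trace w != 0.
Proof.
have F1 := finNzRing_gt1 F.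
case: (pickP (fun w : finvect_type L => fin_trace (w : L) != 0)) => [w|no].
  by exists w.
(* If the trace vanished identically, this identity would read [q * q^n = q^n]. *)
have := sum_ker_trace L; rewrite (eq_bigr (fun=> 1)) => [|z _]; last first.
  by have /negbFE -> := no z.
rewrite sumr_const natz card_fin_ext -!natz natrX -exprS => /eqP.
by rewrite -!natrX eqr_nat eqn_exp2l // -[X in _ == X]addn0 -addn1 eqn_add2l.
Qed.

(** * The trace form and its determinant *)

Definition trace_gram (F : finFieldType) (L : fieldExtType F) : 'M[F]_(dim L) :=
  \matrix_(i, j) fin_trace (r2v 'e_i * r2v 'e_j : L).

Lemma trace_gramE (F : finFieldType) (L : fieldExtType F)
    (u v : 'rV[F]_(dim L)) :
  u *m trace_gram L *m v^T = (fin_trace (r2v u * r2v v : L))%:M.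
Proof.
apply/matrixP => i j; rewrite !ord1 [RHS]mxE eqxx mulr1n mxE.
rewrite [v in RHS]row_sum_delta linear_sum mulr_sumr raddf_sum /=.
apply: eq_bigr => k _; rewrite !mxE linearZ -scalerAr linearZ /= mulrC.
congr (_ * _).
rewrite [u in RHS]row_sum_delta linear_sum mulr_suml raddf_sum /=.
by apply: eq_bigr => l _; rewrite !mxE linearZ -scalerAl linearZ.
Qed.

Lemma trace_gram_sym (F : finFieldType) (L : fieldExtType F) :
  (trace_gram L)^T = trace_gram L.
Proof. by apply/matrixP => i j; rewrite !mxE mulrC. Qed.

Lemma trace_gram_unit (F : finFieldType) (L : fieldExtType F) :
  trace_gram L \in unitmx.
Proof.
rewrite unitmxE unitfE; apply/det0P => -[v v0 vG].
have [w w0] := fin_trace_neq0 L; case/eqP: w0.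
have u0 : r2v v != 0 :> L.
  by apply: contraNneq v0 => u0; rewrite -(r2vK v) u0 linear0.
(* As [w = u * (u^-1 * w)] with [u = r2v v] in the radical, the trace of [w] must vanish. *)
rewrite -(mulVKf u0 w) -(v2rK (_ * w)).
have := trace_gramE v (v2r ((r2v v)^-1 * w)); rewrite vG mul0mx.
by move/matrixP => /(_ 0 0); rewrite !mxE eqxx.
Qed.

Lemma form_sols_trace (F : finFieldType) (L : fieldExtType F) (c : F) :
  form_sols (trace_gram L) c
  = \sum_(z : finvect_type L) (fin_trace ((z : L) ^+ 2) == c)%:R.
Proof.
have bij : {on [pred _ | true], bijective
    (fun v : 'rV[F]_(dim L) => r2v v : finvect_type L)}.
  by exists v2r => x _; [exact: r2vK | exact: v2rK].
rewrite (reindex _ bij) /=; apply: eq_bigr => v _; rewrite trace_gramE -expr2.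
congr (nat_of_bool _)%:R; apply/eqP/eqP => [/matrixP /(_ 0 0)|-> //].
by rewrite !mxE.
Qed.

(* The matrix [M] of the conjugates of a basis satisfies [M *m M^T = G], and the
   Frobenius map permutes the columns of [M] by an [n]-cycle.  Hence
   [\det M], a square root of [\det G], lies in [F] exactly when [n] is odd. *)
Lemma quad_char_det_trace (F : finFieldType) (L : fieldExtType F) n
    (e : 'I_n -> L) :
  2%:R != 0 :> F -> \dim {:L} = n ->
  let G := \matrix_(i, j) fin_trace (e i * e j) in
  \det G != 0 -> quad_char (\det G) = if odd n then 1 else - 1.
Proof.
case: n e => [|n] e F2 dimL G G0.
  by have := adim_gt0 {:L}%AS; rewrite dimL.
pose M : 'M[L]_n.+1 := \matrix_(i, j) e i ^+ (#|F| ^ j).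
have MG : \det M ^+ 2 = (\det G)%:A.
  rewrite -[RHS]/(in_alg L (\det G)) -det_map_mx expr2 -[in X in _ * X]det_tr.
  rewrite -det_mulmx; congr (\det _); apply/matrixP => i j; rewrite !mxE.
  rewrite /= fin_traceE /trace_sum dimL; apply: eq_bigr => k _.
  by rewrite !mxE exprMn.
have frobM : frobenius (\det M) = (-1) ^+ n * \det M.
  (* The cyclic shift [j -> j + 1], with [ord_max] sent to [ord0] because [x^(q^(n+1)) = x]. The
     dimension is now [n.+1], so the sign is [(-1)^n]. *)
  pose s : {perm 'I_n.+1} := lift_perm ord_max ord0 1.
  have -> : frobenius (\det M) = \det (col_perm s M).
    rewrite -[LHS]/(frobenius _) -det_map_mx; congr (\det _).
    apply/matrixP => i j; rewrite !mxE expXcard -iterS -expXcard.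
    case: (unliftP ord_max j) => [k ->|->].
      by rewrite lift_perm_lift perm1 lift_max lift0. 
    rewrite lift_perm_id expn0 expr1 /= -dimL.
    by apply/eqP; rewrite -(Fermat's_little_theorem {:L}%AS) memvf.
  rewrite col_permE det_mulmx det_perm mulrC odd_permV odd_lift_perm odd_perm1.
  by rewrite /= !addbF signr_odd.
have M0 : \det M != 0.
  apply: contraNneq G0 => M0; move: MG; rewrite M0 expr0n /= => /esym/eqP.
  by rewrite scaler_eq0 oner_eq0 orbF.
rewrite /quad_char (negPf G0) /=; move: frobM; rewrite -signr_odd.
case: (odd n) => /= frobM.
  (* Even dimension: were [\det G = b^2], then [\det M], being [b] or [- b], would be fixed by
     Frobenius, which negates it. *)
  case: existsP => // -[b /eqP bG]; case/eqP: M0.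
  have Mb : frobenius (\det M) = \det M.
    have : \det M ^+ 2 == b%:A ^+ 2.
      by rewrite MG -bG -!in_algE rmorphXn.
    rewrite eqf_sqr => /orP[] /eqP ->; rewrite ?rmorphN.
      exact: frobenius_alg.
    by congr (- _); exact: frobenius_alg.
  move/eqP: frobM; rewrite Mb mulN1r -addr_eq0 -mulr2n -scaler_nat.
  by rewrite scaler_eq0 (negPf F2) => /eqP.
have /frobeniusP [b Mb] : frobenius (\det M) == \det M by rewrite frobM mul1r.
case: existsP => // -[]; exists b; apply/eqP/(@alg_inj F L).
by rewrite -MG Mb -!in_algE rmorphXn.
Qed.

(** * From the curve to the trace form *)

(** The number written [h] in the opening outline. *)
Definition null_trace_sols (F : finFieldType) (L : fieldExtType F)
    (c : F) : int :=
  \sum_(z : finvect_type L)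
    (fin_trace (z : L) == 0)%:R * (fin_trace ((z : L) ^+ 2) == c)%:R.

(** With [z = w + s] the terms [n * s^2] cancel, leaving [Tr (w^2) + 2 s Tr w = c]: if [Tr w = 0],
    all [s] or none are solutions; otherwise exactly one is. *)
Lemma sum_trace_sols (F : finFieldType) (L : fieldExtType F) (c : F) :
  2%:R != 0 :> F ->
  \sum_(s : F) form_sols (trace_gram L) (c + (\dim {:L})%:R * s ^+ 2)
  = #|F|%:Z * null_trace_sols L c
    + \sum_(w : finvect_type L) (fin_trace (w : L) != 0)%:R.
Proof.
move=> F2; pose V := finvect_type L.
pose g (w : V) (s : F) :=
  fin_trace ((w : L) ^+ 2) + 2%:R * s * fin_trace (w : L).
rewrite (eq_bigr (fun s => \sum_(w : V) (g w s == c)%:R)) => [|s _]; last first.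
  rewrite form_sols_trace.
  have inj : injective (fun w : V => (w : L) + s%:A : V) by apply: addIr.
  rewrite (reindex_inj inj) /=; apply: eq_bigr => w _.
  have -> : fin_trace (((w : L) + s%:A) ^+ 2) = g w s + (\dim {:L})%:R * s ^+ 2.
    rewrite sqrrD !raddfD /= /g -fin_trace_alg.
    have -> : (s%:A : L) ^+ 2 = (s ^+ 2)%:A by rewrite -!in_algE rmorphXn.
    congr (_ + _ + _).
    by rewrite mulr_algr linearZ /=; ring.
  by rewrite (inj_eq (addIr _)).
rewrite exchange_big /= mulr_sumr -big_split /=; apply: eq_bigr => w _.
rewrite /g; case: (eqVneq (fin_trace (w : L)) 0) => [->|w0].
  under eq_bigr => s _ do rewrite mulr0 addr0.
  by rewrite mul1r addr0 sumr_const -[LHS]mulr_natl natz.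
rewrite mul0r mulr0 add0r.
pose s0 := (c - fin_trace ((w : L) ^+ 2)) / (2%:R * fin_trace (w : L)).
rewrite -[RHS](sum_delta (fun=> 1) s0); apply: eq_bigr => s _.
rewrite mulr1; congr (nat_of_bool _)%:R.
by apply/eqP/eqP => h; [rewrite /s0 -h | rewrite -h /s0]; field; rewrite w0 F2.
Qed.

(** For fixed [x] there are [q] or no values of [y], by a trace condition that depends on [x] only
    through [artin_schreier x]. The fibre count in [x] gives the second factor [q]. *)
Lemma card_curve_points (F : finFieldType) (L : fieldExtType F) (lambda : L) :
  2%:R != 0 :> F ->
  #|curve_points lambda|%:Z
  = #|F|%:Z ^+ 2 * null_trace_sols L (- (2%:R * fin_trace lambda)).
Proof.
move=> F2; pose V := finvect_type L.
pose R (x : V) : L := (x : L) ^+ #|F|.+1 - (x : L) ^+ 2 - lambda.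
have -> : #|curve_points lambda|%:Z
    = \sum_(x : V) \sum_(y : V) (artin_schreier (y : L) == R x)%:R.
  rewrite pair_big /= sum_nat_of_bool.
  by congr Posz; apply: eq_card => u; rewrite !inE.
under eq_bigr => x _ do rewrite artin_schreier_fiber.
rewrite -mulr_sumr -mulrA; congr (_ * _).
set c := - _.
pose f (z : V) : int := (fin_trace ((z : L) ^+ 2) == c)%:R.
rewrite (eq_bigr (fun x : V => f (artin_schreier (x : L)))) => [|x _]; last first.
  congr (nat_of_bool _)%:R.
  have -> : fin_trace (artin_schreier (x : L) ^+ 2)
      = c - 2%:R * fin_trace (R x).
    have xq : (x : L) ^+ #|F|.+1 = (x : L) * frobenius (x : L) by rewrite exprS.
    rewrite /R /artin_schreier xq sqrrB -rmorphXn !(raddfB, raddfD) /=.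
    by rewrite fin_trace_frobenius /c [frobenius _ * _]mulrC; ring.
  by rewrite -[RHS]subr_eq0 addrAC subrr sub0r oppr_eq0 mulf_eq0 (negPf F2).
under eq_bigr => x _ do rewrite -(sum_delta f (artin_schreier (x : L) : V)).
rewrite exchange_big /null_trace_sols mulr_sumr; apply: eq_bigr => z _ /=.
by rewrite -mulr_suml artin_schreier_fiber mulrA.
Qed.

(** The extra powers of [q] are [q] times the number [q^n - q^(n-1)] of elements of nonzero
    trace. *)
Lemma curve_points_form_count (F : finFieldType) (L : fieldExtType F)
    (lambda : L) :
  2%:R != 0 :> F -> let n := \dim {:L} in
  #|curve_points lambda|%:Z + #|F|%:Z ^+ n.+1 - #|F|%:Z ^+ n
  = \sum_(s : F) form_count n (\det (trace_gram L))
      (- (2%:R * fin_trace lambda) + n%:R * s ^+ 2).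
Proof.
move=> F2 n; rewrite card_curve_points //.
rewrite [RHS](eq_bigr (fun s => #|F|%:Z * form_sols (trace_gram L)
  (- (2%:R * fin_trace lambda) + n%:R * s ^+ 2))) => [|s _]; last first.
  by rewrite card_form_sols ?trace_gram_sym ?trace_gram_unit // /n dimvf.
rewrite -mulr_sumr sum_trace_sols // mulrDr mulrA -expr2 -addrA; congr (_ + _).
have total : \sum_(w : finvect_type L) (fin_trace (w : L) == 0)%:R
    + \sum_(w : finvect_type L) (fin_trace (w : L) != 0)%:R = #|F|%:Z ^+ n.
  rewrite -big_split /= (eq_bigr (fun=> 1)) => [|w _].
    by rewrite sumr_const natz card_fin_ext -!natz natrX.
  by case: (fin_trace _ == 0).
by rewrite exprS -{1}total mulrDr sum_ker_trace addrAC subrr add0r.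
Qed.

Theorem theorem3p7 (p s n : nat) (F : finFieldType) (L : fieldExtType F)
    (lambda : L) :
  prime p -> odd p -> #|F| = (p ^ s)%N -> (0 < n)%N -> \dim {:L} = n ->
  let q : int := #|F|%:Z in
  let tr : F := fin_trace lambda in
  let N : int := #|curve_points lambda|%:Z in
  [/\ (gcdn n p = 1%N -> ~~ odd n ->
        N = q ^+ n
            - quad_char (2%:R * (-1) ^+ (n./2) * n%:R * tr) * q ^+ ((n + 2)./2)),
      (gcdn n p = 1%N -> odd n ->
        N = q ^+ n
            + eps tr * quad_char ((-1) ^+ ((n - 1)./2) * n%:R : F)
              * q ^+ ((n + 1)./2)),
      (gcdn n p = p -> ~~ odd n ->
        N = q ^+ n
            - eps tr * quad_char ((-1) ^+ (n./2) : F) * q ^+ ((n + 2)./2))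
    & (gcdn n p = p -> odd n ->
        N = q ^+ n
            + quad_char (2%:R * (-1) ^+ ((n - 3)./2) * tr) * q ^+ ((n + 3)./2))].
Proof.
move=> p_pr p_odd cardF n_gt0 dimL q tr N.
have pF := card_finPcharP cardF p_pr.
have charF k : (k%:R == 0 :> F) = (p %| k)%N by rewrite (dvdn_pcharf pF).
have F2 : 2%:R != 0 :> F.
  by rewrite charF; apply/negP => /dvdn_leq; have := prime_gt1 p_pr; lia.
have := curve_points_form_count lambda F2.
rewrite /= dimL -/N -/tr -/q; set d := \det _; set c := - (2%:R * tr).
move/(canRL (subrK _))/(canRL (addrK _)) => count.
have d0 : d != 0 by rewrite -unitfE -unitmxE trace_gram_unit.
have disc : quad_char d = if odd n then 1 else -1.
  rewrite -dimL dimvf.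
  exact: (quad_char_det_trace (e := fun i => r2v 'e_i : L) F2 (dimvf L) d0).
have epsc : eps c = eps tr by rewrite /eps /c oppr_eq0 mulf_eq0 (negPf F2).
(* Here [n] is nonzero in [F], so [s] is a genuine extra variable with coefficient [- n]. *)
have coprime_count : gcdn n p = 1%N ->
    N = form_count n.+1 (- n%:R * d) c - q ^+ n.+1 + q ^+ n.
  move=> np; have n0 : n%:R != 0 :> F.
    by rewrite charF -prime_coprime // coprime_sym /coprime np.
  rewrite -sum_form_count ?oppr_eq0 //.
  under eq_bigr => x _ do rewrite mulNr opprK.
  by rewrite count addrAC.
(* Here [n = 0] in [F], so the sum over [s] consists of [q] equal terms. *)
have dvd_count : gcdn n p = p -> N = q * form_count n d c - q ^+ n.+1 + q ^+ n.
  move=> np; have n0 : n%:R = 0 :> F.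
    by apply/eqP; rewrite charF -np dvdn_gcdl.
  move: count; rewrite n0; under eq_bigr => x _ do rewrite mul0r addr0.
  rewrite sumr_const -[_ *+ _]mulr_natl natz => count.
  by rewrite count addrAC.
split=> np n_odd.
- rewrite coprime_count // /form_count -/q /= n_odd.
  have -> : uphalf n = n./2 by lia.
  have -> : (n + 2)./2 = n./2.+1 by lia.
  (* The signs of [- n] and [c] cancel; the minus sign of the result comes from [quad_char d]. *)
  have -> : (-1) ^+ n./2 * (- n%:R * d) * c
      = 2%:R * (-1) ^+ n./2 * n%:R * tr * d.
    by rewrite /c; ring.
  by rewrite quad_charM // disc (negPf n_odd); ring.
- rewrite coprime_count // /form_count -/q /= n_odd /= epsc.
  have -> : uphalf n = n./2.+1 by lia.
  have -> : (n - 1)./2 = n./2 by lia.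
  have -> : (n + 1)./2 = n./2.+1 by lia.
  have -> : (-1) ^+ n./2.+1 * (- n%:R * d) = (-1) ^+ n./2 * n%:R * d.
    by rewrite exprS; ring.
  by rewrite [X in eps tr * X]quad_charM // disc n_odd; ring.
- rewrite dvd_count // /form_count -/q (negPf n_odd) epsc quad_charM //.
  have -> : (n + 2)./2 = n./2.+1 by lia.
  by rewrite disc (negPf n_odd) !exprS; ring.
(* An odd prime divides [n], so [n >= 3] and the truncated subtraction [n - 3] is exact. *)
have n3 : (2 < n)%N.
  have := dvdn_leq n_gt0 (_ : p %| n)%N; rewrite -{1}np dvdn_gcdl => /(_ isT).
  by have := prime_gt1 p_pr; lia.
rewrite dvd_count // /form_count -/q n_odd.
have -> : n./2 = (n - 3)./2.+1 by lia.
have -> : (n + 3)./2 = (n - 3)./2.+3 by lia.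
(* The sign of [c] lowers the exponent from [(n - 1)/2] to [(n - 3)/2]. *)
have -> : (-1) ^+ (n - 3)./2.+1 * d * c = 2%:R * (-1) ^+ (n - 3)./2 * tr * d.
  by rewrite /c exprS; ring.
by rewrite quad_charM // disc n_odd !exprS; ring.
Qed.
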